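(* Let $E$ be a binary exposure, $D$ a binary outcome and $U$ an unmeasured confounder with values in an arbitrary measurable space, and let $\mathrm{CRR}_{ED}=\mathrm{RR}^{\mathrm{obs}}_{ED}/\mathrm{RR}^{\mathrm{true}}_{ED}$, with $\mathrm{CRR}_{ED}\ge 1$. Then $$\min(\mathrm{RR}_{EU},\mathrm{RR}_{UD})\ge \mathrm{CRR}_{ED},\qquad \max(\mathrm{RR}_{EU},\mathrm{RR}_{UD})\ge \mathrm{CRR}_{ED}+\sqrt{\mathrm{CRR}_{ED}(\mathrm{CRR}_{ED}-1)}.$$
   Context: All probabilities are conditional on a fixed stratum of the measured confounders (suppressed). $E,D\in\{0,1\}$ are random variables on a probability space $(\Omega,\mathcal F,P)$ with $0<P(E=1)<1$, and $U:\Omega\to\Upsilon$ is measurable into a measurable space $(\Upsilon,\mathcal U)$. For $V\in\mathcal U$: $F_1(V)=P(U\in V\mid E=1)$, $F_0(V)=P(U\in V\mid E=0)$, $F(V)=P(U\in V)$. It is assumed that $F_1$ is absolutely continuous with respect to $F_0$, with Radon–Nikodym derivative $\mathrm{RR}_{EU}(u)=F_1(du)/F_0(du)$. Put $r(u)=P(D=1\mid E=0,U=u)$ and $r^*(u)=P(D=1\mid E=1,U=u)$ (fixed measurable versions). Maxima and minima over $u\in\Upsilon$ are assumed to exist, with $\min_u r(u)>0$ and $\min_u r^*(u)>0$, so that all ratios are defined. $\mathrm{RR}_{EU}=\max_u \mathrm{RR}_{EU}(u)$; $\mathrm{RR}_{UD|E=0}=\max_u r(u)/\min_u r(u)$; $\mathrm{RR}_{UD|E=1}=\max_u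 r^*(u)/\min_u r^*(u)$; $\mathrm{RR}_{UD}=\max(\mathrm{RR}_{UD|E=0},\mathrm{RR}_{UD|E=1})$. $\mathrm{RR}^{\mathrm{obs}}_{ED}=\dfrac{\int r^*(u)F_1(du)}{\int r(u)F_0(du)}$ and $\mathrm{RR}^{\mathrm{true}}_{ED}=\dfrac{\int r^*(u)F(du)}{\int r(u)F(du)}$. *)

(* Defs.v *)
From HB Require Import structures.
From mathcomp Require Import all_boot all_order all_algebra.
From mathcomp Require Import all_classical all_reals all_analysis.

Set Implicit Arguments.
Unset Strict Implicit.
Unset Printing Implicit Defensive.

Import Order.TTheory GRing.Theory Num.Theory.
Import numFieldNormedType.Exports.

Local Open Scope classical_set_scope.
Local Open Scope ring_scope.

Section extrema.
Context {T : Type} {R : realType}.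
Implicit Types (f : T -> R) (m : R).

(* Maxima and minima are pointwise (not essential) and attained. *)
Definition is_max f m := range f m /\ ubound (range f) m.
Definition is_min f m := range f m /\ lbound (range f) m.

End extrema.

Section conditioning.
Context {d : measure_display} {T : measurableType d} {R : realType}.
Variable P : probability T R.

(* The measure P( . | B), i.e. A |-> P (A `&` B) / P B when P B != 0.
   The last argument of mnormalize is the default value used when P B = 0. *)
Definition condP (B : set T) (mB : measurable B) : probability T R :=
  mnormalize (mrestr P mB) P.

Lemma condPE (B : set T) (mB : measurable B) (A : set T) : P B != 0%E ->
  condP mB A = (P (A `&` B) * (fine (P B))^-1%:E)%E.
Proof.
move=> PB0; have PBoo : P B != +oo%E.
  by rewrite lt_eqF// (le_lt_trans (probability_le1 P mB))// ltry.
suff mnE (mu : {measure set T -> \bar R}) : mu [set: T] = P B ->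
    mnormalize mu P A = (mu A * (fine (P B))^-1%:E)%E.
  by apply: (mnE (mrestr P mB)); rewrite /= /mrestr setTI.
by move=> muT; rewrite /mnormalize muT (negbTE PB0) (negbTE PBoo).
Qed.

Lemma measurable_level (X : {RV P >-> bool}) (b : bool) :
  measurable (X @^-1` [set b]).
Proof. exact: measurable_funPTI. Qed.

Definition condP_level (X : {RV P >-> bool}) (b : bool) : probability T R :=
  condP (measurable_level X b).

End conditioning.

Section confounding.
Context {d d' : measure_display} {T : measurableType d} {Y : measurableType d'}
  {R : realType}.
Variable P : probability T R.
Variables (E D : {RV P >-> bool}) (U : {RV P >-> Y}).

(* F_1 = law_given E U true,  F_0 = law_given E U false,
   F = distribution P U. *)
Definition law_given (e : bool) : probability Y R :=
  distribution (condP_level E e) U.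

(* f is a measurable version of the Radon-Nikodym derivative
   F_1(du) / F_0(du); the library fixes one version, and f is
   any real-valued function agreeing with it F_0-almost everywhere. *)
Definition is_RR_EU (f : Y -> R) : Prop :=
  measurable_fun [set: Y] f /\
  {ae law_given false, forall u,
    Radon_Nikodym (charge_of_finite_measure (law_given true))
      (law_given false) u = (f u)%:E}.

(* f is a version of u |-> P(D = 1 | E = e, U = u). *)
Definition is_outcome_prob (e : bool) (f : Y -> R) : Prop :=
  measurable_fun [set: Y] f /\
  forall V : set Y, measurable V ->
    condP_level E e (D @^-1` [set true] `&` U @^-1` V) =
    (\int[law_given e]_(u in V) (f u)%:E)%E.

(* In the following, r is a version of P(D = 1 | E = 0, U = .) and rs one of
   P(D = 1 | E = 1, U = .). *)
Definition RRobs (r rs : Y -> R) : R :=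
  (\int[law_given true]_(u in [set: Y]) rs u) /
  (\int[law_given false]_(u in [set: Y]) r u).

Definition RRtrue (r rs : Y -> R) : R :=
  (\int[distribution P U]_(u in [set: Y]) rs u) /
  (\int[distribution P U]_(u in [set: Y]) r u).

Definition CRR (r rs : Y -> R) : R := RRobs r rs / RRtrue r rs.

End confounding.

(* Main.v *)
Require Import Defs.
From mathcomp Require Import all_boot all_order all_algebra.
From mathcomp Require Import all_classical all_reals all_analysis.
From mathcomp Require Import measurable_realfun ring lra.

(* Write p = P(E = 1), b_e for the integral of r and a_e for that of rs with
   respect to F_e, x = RR_EU and y = RR_UD.  As F = p F_1 + (1 - p) F_0,
     CRR = (p b_1/b_0 + (1 - p)) / (p + (1 - p) a_0/a_1),
   so an upper bound K for both b_1/b_0 and a_1/a_0 is one for CRR.  Since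
   x F_0 - F_1 is a nonnegative measure of mass x - 1, integrating r >= min r
   against it gives b_1 + (x - 1) min r <= x b_0; together with
   b_1 <= max r <= y min r this yields b_1/b_0 <= x y / (x + y - 1), and
   similarly for rs.  Both claims are then inequalities between real numbers
   derived from CRR <= x y / (x + y - 1). *)

Import Order.TTheory GRing.Theory Num.Theory.
Import numFieldNormedType.Exports.

Local Open Scope classical_set_scope.
Local Open Scope ring_scope.

(** * Elementary inequalities around the bounding factor [x * y / (x + y - 1)] *)

Section real_inequalities.
Context {R : realType}.
Implicit Types x y c : R.

(** Once the positive denominators are cleared, the claim is the sum of the last hypothesis weighted
    by [p * a1] and of the one before it weighted by [(1 - p) * b0]. *)
Lemma ratio_mixture_le (p a1 a0 b1 b0 K : R) :
  0 <= p <= 1 -> 0 < a1 -> 0 < a0 -> 0 < b1 -> 0 < b0 ->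
  a1 <= K * a0 -> b1 <= K * b0 ->
  a1 / b0 / ((p * a1 + (1 - p) * a0) / (p * b1 + (1 - p) * b0)) <= K.
Proof.
move=> /andP[p0 p1] a1_gt0 a0_gt0 b1_gt0 b0_gt0 a1K b1K.
have mix_gt0 s t : 0 < s -> 0 < t -> 0 < p * s + (1 - p) * t.
  move=> s0 t0; have [->|p_neq0] := eqVneq p 0.
    by rewrite mul0r add0r subr0 mul1r.
  by rewrite ltr_wpDr ?mulr_ge0 ?subr_ge0 ?(ltW t0)// mulr_gt0// lt0r p_neq0.
have pa_gt0 := mix_gt0 _ _ a1_gt0 a0_gt0; have pb_gt0 := mix_gt0 _ _ b1_gt0 b0_gt0.
rewrite invf_div mulf_div ler_pdivrMr ?mulr_gt0//.
have h1 : p * a1 * b1 <= p * a1 * (K * b0) by rewrite ler_wpM2l// mulr_ge0// ltW.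
have h2 : (1 - p) * b0 * a1 <= (1 - p) * b0 * (K * a0).
  by rewrite ler_wpM2l// mulr_ge0 ?subr_ge0// ltW.
lra.
Qed.

(** Since [c * (x + y - 1) - x * y = y * (c - x) + c * (x - 1)], having [x < c] would contradict the
    last hypothesis; [y] is symmetric. *)
Lemma bounding_factor_min x y c : 1 <= x -> 1 <= y ->
  c * (x + y - 1) <= x * y -> c <= Num.min x y.
Proof.
move=> x1 y1 cxy; rewrite le_min; apply/andP; split; rewrite leNgt; apply/negP => cx; nra.
Qed.

(** The last hypothesis rearranges to [c * (c - 1) <= (x - c) * (y - c)]. Both factors are
    nonnegative by [bounding_factor_min], so the larger is at least the square root. *)
Lemma bounding_factor_max x y c : 1 <= x -> 1 <= y -> 1 <= c ->
  c * (x + y - 1) <= x * y -> c + Num.sqrt (c * (c - 1)) <= Num.max x y.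
Proof.
move=> x1 y1 c1 cxy.
have := bounding_factor_min x y c x1 y1 cxy; rewrite le_min => /andP[cx cy].
rewrite -lerBrDl; set z := Num.max x y.
have xz : x <= z by rewrite le_max lexx.
have yz : y <= z by rewrite le_max lexx orbT.
have zc : 0 <= z - c by lra.
(* x y / (x + y - 1) is nondecreasing in each variable, so x = y = z is the worst case. *)
have cz : c * (z + z - 1) <= z * z by nra.
by rewrite -(ger0_norm zc) -sqrtr_sqr ler_wsqrtr//; nra.
Qed.

End real_inequalities.

(** * Bounded densities and integrability of bounded functions *)

Section integration.
Context {d : measure_display} {T : measurableType d} {R : realType}.

Lemma ae_eq_integrable (mu : {measure set T -> \bar R}) (A : set T)
    (f g : T -> \bar R) : measurable A -> measurable_fun A g ->
  ae_eq mu A f g -> mu.-integrable A f -> mu.-integrable A g.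
Proof.
move=> mA mg fg /integrableP[mf foo]; apply/integrableP; split=> //.
rewrite -(@ae_eq_integral _ _ _ mu A (abse \o g) (abse \o f))//.
- exact: measurableT_comp.
- exact: measurableT_comp.
- exact: ae_eq_comp.
Qed.

(** Integrate [f <= c] over [A]. The bound on the density enters the main argument only through this
    setwise domination. *)
Lemma le_Radon_Nikodym (mu nu : {finite_measure set T -> \bar R})
    (f : T -> R) (c : R) (A : set T) :
  nu `<< mu -> measurable_fun [set: T] f ->
  {ae mu, forall x,
    Radon_Nikodym (charge_of_finite_measure nu) mu x = (f x)%:E} ->
  (forall x, f x <= c) -> measurable A -> (nu A <= c%:E * mu A)%E.
Proof.
move=> numu mf RNf fc mA.
have mfA : measurable_fun A (EFin \o f).
  by apply/measurable_EFinP; exact: measurable_funTS.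
have RNA : mu.-integrable A (Radon_Nikodym (charge_of_finite_measure nu) mu).
  by apply: (integrableS measurableT) => //; exact: Radon_Nikodym_integrable.
have RNfA : ae_eq mu A (Radon_Nikodym (charge_of_finite_measure nu) mu)
    (EFin \o f).
  by apply: filterS RNf => x ->.
have -> : nu A = (\int[mu]_(x in A) (f x)%:E)%E.
  rewrite -[LHS]/(charge_of_finite_measure nu A).
  rewrite (Radon_Nikodym_integral (nu := charge_of_finite_measure nu) numu mA).
  by apply: ae_eq_integral => //; exact: measurable_int RNA.
rewrite -integral_cst//; apply: le_integral => //.
- exact: ae_eq_integrable RNfA RNA.
- exact: finite_measure_integrable_cst.
- by move=> x _; rewrite lee_fin.
Qed.

Lemma itv_bounded_integrable (mu : {finite_measure set T -> \bar R})
    (g : T -> R) (m M : R) : measurable_fun [set: T] g ->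
  (forall x, m <= g x) -> (forall x, g x <= M) ->
  mu.-integrable [set: T] (EFin \o g).
Proof.
move=> mg gm gM.
apply: measurable_bounded_integrable => //.
  by rewrite -ge0_fin_numE// fin_num_measure.
exists (Num.max `|m| `|M|); split; first exact: num_real.
move=> K ltK x _ /=; apply: le_trans (ltW ltK).
rewrite ler_norml; apply/andP; split.
  rewrite (le_trans _ (gm x))// lerNl (le_trans (ler_norm _))// normrN.
  by rewrite le_max lexx.
by rewrite (le_trans (gM x))// (le_trans (ler_norm _))// le_max lexx orbT.
Qed.

Lemma Rintegral_prob_cst (mu : probability T R) (k : R) : \int[mu]_(x in [set: T]) k = k.
Proof.
by rewrite Rintegral_cst// [X in fine X](@probability_setT _ _ _ mu) mulr1.
Qed.

End integration.

(** * Integrals of one bounded function under dominated measures and mixtures *)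

Section bounded_functions.
Context {d : measure_display} {T : measurableType d} {R : realType}.
Implicit Types mu nu : probability T R.
Variables (g : T -> R) (m M : R).
Hypotheses (mg : measurable_fun [set: T] g).
Hypotheses (gm : forall x, m <= g x) (gM : forall x, g x <= M).

Lemma Rintegral_itv mu : m <= \int[mu]_(x in [set: T]) g x <= M.
Proof.
have gi := itv_bounded_integrable mu g m M mg gm gM.
apply/andP; split.
  rewrite -[leLHS](Rintegral_prob_cst mu); apply: le_Rintegral => //.
  exact: finite_measure_integrable_cst.
rewrite -[leRHS](Rintegral_prob_cst mu); apply: le_Rintegral => //.
exact: finite_measure_integrable_cst.
Qed.

(** Setwise domination passes to integrals of nonnegative functions, here [g - m]; as both measures
    have mass 1, the shift costs exactly [m] on each side. *)
Lemma Rintegral_dominated mu nu (c : R) : 0 <= c ->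
  (forall A, measurable A -> (nu A <= c%:E * mu A)%E) ->
  \int[nu]_(x in [set: T]) g x - m <=
    c * (\int[mu]_(x in [set: T]) g x - m).
Proof.
move=> c0 nuc.
have mgm : measurable_fun [set: T] (fun x => (g x - m)%:E).
  by apply/measurable_EFinP; exact: measurable_funB.
have gm0 x : (0 <= (g x - m)%:E)%E by rewrite lee_fin subr_ge0.
have Bm (la : probability T R) :
    \int[la]_(x in [set: T]) g x - m = \int[la]_(x in [set: T]) (g x - m).
  rewrite RintegralB// ?Rintegral_prob_cst//; first exact: itv_bounded_integrable gm gM.
  exact: finite_measure_integrable_cst.
have gBi (la : probability T R) :
    la.-integrable [set: T] (fun x => (g x - m)%:E).
  apply: (itv_bounded_integrable la (fun x => g x - m) 0 (M - m)).
  - exact: measurable_funB.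
  - by move=> x; rewrite subr_ge0.
  - by move=> x; rewrite lerB.
rewrite !Bm -lee_fin /Rintegral EFinM !fineK; last 2 first.
- by apply: integrable_fin_num => //; exact: gBi.
- by apply: integrable_fin_num => //; exact: gBi.
rewrite -(ge0_integral_mscale mu measurableT (NngNum c0))//.
exact: ge0_le_measure_integral.
Qed.

(** Add [y] times the bound of [Rintegral_dominated] to [c - 1] times [b1 <= y * m]: the terms in
    [m] cancel. *)
Lemma Rintegral_bounding_factor mu nu (c y : R) : 1 <= c -> 0 < m -> M <= y * m ->
  (forall A, measurable A -> (nu A <= c%:E * mu A)%E) ->
  (\int[nu]_(x in [set: T]) g x) * (c + y - 1) <=
    c * y * \int[mu]_(x in [set: T]) g x.
Proof.
move=> c1 m0 My nuc.
have := Rintegral_dominated mu nu c (le_trans ler01 c1) nuc.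
have /andP[mb0 _] := Rintegral_itv mu.
have /andP[mb1 b1M] := Rintegral_itv nu.
set b0 := Rintegral mu _ _ in mb0 *; set b1 := Rintegral nu _ _ in mb1 b1M *.
move=> b10.
have y0 : 0 <= y.
  rewrite -(pmulr_lge0 _ m0); apply: le_trans My.
  by apply: le_trans b1M; apply: le_trans mb1; exact: ltW.
have h1 : y * (b1 - m) <= y * (c * (b0 - m)) by rewrite ler_wpM2l.
have h2 : (c - 1) * b1 <= (c - 1) * (y * m).
  by rewrite ler_wpM2l ?subr_ge0// (le_trans b1M).
lra.
Qed.

Lemma Rintegral_mixture mu nu (la : probability T R) (p : R) : 0 <= p <= 1 -> 0 <= m ->
  (forall A, measurable A -> la A = p%:E * nu A + (1 - p)%:E * mu A)%E ->
  \int[la]_(x in [set: T]) g x =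
    p * (\int[nu]_(x in [set: T]) g x) +
    (1 - p) * \int[mu]_(x in [set: T]) g x.
Proof.
move=> /andP[p0]; rewrite -subr_ge0 => q0 m0 laE.
have g0 x : [set: T] x -> (0 <= (g x)%:E)%E.
  by move=> _; rewrite lee_fin (le_trans m0).
have mEg : measurable_fun [set: T] (fun x => (g x)%:E) by exact/measurable_EFinP.
apply: EFin_inj; rewrite EFinD !EFinM /Rintegral.
rewrite !fineK; last 3 first.
- by apply: integrable_fin_num => //; exact: itv_bounded_integrable gm gM.
- by apply: integrable_fin_num => //; exact: itv_bounded_integrable gm gM.
- by apply: integrable_fin_num => //; exact: itv_bounded_integrable gm gM.
rewrite (eq_measure_integral
  (measure_add (mscale (NngNum p0) nu) (mscale (NngNum q0) mu))).
  by rewrite ge0_integral_measure_add// !ge0_integral_mscale.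
by move=> A mA _; rewrite [LHS]laE//; apply: esym; exact: measure_addE.
Qed.

End bounded_functions.

(** * The law of [U] as a mixture over the exposure *)

Section law_of_total_probability.
Context {d d' : measure_display} {T : measurableType d} {Y : measurableType d'}
  {R : realType}.
Variables (P : probability T R) (E : {RV P >-> bool}) (U : {RV P >-> Y}).

Lemma total_probability_law (V : set Y) : measurable V ->
  (0 < P (E @^-1` [set true]) < 1)%E ->
  distribution P U V =
    ((fine (P (E @^-1` [set true])))%:E * law_given E U true V +
     (1 - fine (P (E @^-1` [set true])))%:E * law_given E U false V)%E.
Proof.
move=> mV /andP[PE0 PE1].
have mE b : measurable (E @^-1` [set b]) by exact: measurable_level.
have mU : measurable (U @^-1` V) by exact: measurable_funPTI.
have EC : E @^-1` [set false] = ~` (E @^-1` [set true]).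
  by apply/seteqP; split=> x /=; case: (E x).
have finP A : measurable A -> P A \is a fin_num by move=> mA; exact: fin_num_measure.
have PEF : (1 - fine (P (E @^-1` [set true])))%:E = P (E @^-1` [set false]).
  by rewrite EC probability_setC// EFinB fineK// finP.
(* At probability 0, [condP] is the default [P] and not a quotient; otherwise the factor cancels the
   denominator. *)
have mulK b : P (E @^-1` [set b]) != 0%E ->
    (P (E @^-1` [set b]) * law_given E U b V = P (U @^-1` V `&` E @^-1` [set b]))%E.
  move=> Pb0; have fPb0 : fine (P (E @^-1` [set b])) != 0.
    by rewrite fine_eq0// finP.
  rewrite /law_given /= /pushforward condPE// muleCA -[X in (_ * (X * _))%E]fineK ?finP//.
  by rewrite -EFinM divff// mule1.
have PF0 : P (E @^-1` [set false]) != 0%E.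
  by rewrite EC probability_setC// gt_eqF// sube_gt0.
rewrite PEF fineK ?finP// !mulK//; last by rewrite gt_eqF.
rewrite EC -measureU//; first last.
- by rewrite setIACA setICr setI0.
- by apply: measurableI => //; exact: measurableC.
- exact: measurableI.
by rewrite -setIUr setUv setIT.
Qed.

End law_of_total_probability.

Theorem propositionA3 (R : realType) (d d' : measure_display)
  (Omega : measurableType d) (Y : measurableType d')
  (P : probability Omega R)
  (E D : {RV P >-> bool}) (U : {RV P >-> Y})
  (hE0 : (0 < P (E @^-1` [set true]))%E)
  (hE1 : (P (E @^-1` [set true]) < 1)%E)
  (hac : law_given E U true `<< law_given E U false)
  (rreu r rs : Y -> R)
  (hrreu : is_RR_EU E U rreu)
  (hr : is_outcome_prob E D U false r)
  (hrs : is_outcome_prob E D U true rs)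
  (RREU rmax rmin rsmax rsmin : R)
  (hRREU : is_max rreu RREU)
  (hrmax : is_max r rmax) (hrmin : is_min r rmin)
  (hrsmax : is_max rs rsmax) (hrsmin : is_min rs rsmin)
  (hrmin0 : 0 < rmin) (hrsmin0 : 0 < rsmin)
  (hCRR : 1 <= CRR E U r rs) :
  let RRUD := Num.max (rmax / rmin) (rsmax / rsmin) in
  let crr := CRR E U r rs in
  crr <= Num.min RREU RRUD /\
  crr + Num.sqrt (crr * (crr - 1)) <= Num.max RREU RRUD.
Proof.
move=> RRUD crr.
case: hRREU => _ fmax; case: hrreu => mf fRN.
case: hr => mr _; case: hrs => mrs _.
have fle u : rreu u <= RREU by apply: fmax; exists u.
have [rm rM] : (forall u, rmin <= r u) /\ (forall u, r u <= rmax).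
  by split=> u; [apply: hrmin.2 | apply: hrmax.2]; exists u.
have [rsm rsM] : (forall u, rsmin <= rs u) /\ (forall u, rs u <= rsmax).
  by split=> u; [apply: hrsmin.2 | apply: hrsmax.2]; exists u.
have law_le A : measurable A ->
    (law_given E U true A <= RREU%:E * law_given E U false A)%E.
  by move=> mA; exact: (le_Radon_Nikodym _ _ rreu).
(* On the whole space both laws have mass 1. *)
have RREU1 : 1 <= RREU.
  have := law_le _ measurableT.
  by rewrite !probability_setT mule1 lee_fin.
(* As the larger of the two ratios, [RRUD] serves as a common constant for [r] and [rs]. *)
have rM' : rmax <= RRUD * rmin by rewrite -ler_pdivrMr// le_max lexx.
have rsM' : rsmax <= RRUD * rsmin by rewrite -ler_pdivrMr// le_max lexx orbT.
(* The maximum of [r] is attained, which supplies a point [u] with [rmin <= r u = rmax]. *)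
have RRUD1 : 1 <= RRUD.
  rewrite -(ler_pM2r hrmin0) mul1r; apply: le_trans rM'.
  by case: hrmax => -[u _ <-] _; exact: rm.
have p01 : 0 <= fine (P (E @^-1` [set true])) <= 1.
  rewrite fine_ge0//= -lee_fin fineK ?ltW//.
  by apply: fin_num_measure; exact: measurable_level.
have lawE A : measurable A -> distribution P U A =
    ((fine (P (E @^-1` [set true])))%:E * law_given E U true A +
     (1 - fine (P (E @^-1` [set true])))%:E * law_given E U false A)%E.
  by move=> mA; apply: total_probability_law => //; rewrite hE0.
have pos (mu : probability Y R) (g : Y -> R) (m M : R) : measurable_fun [set: Y] g ->
    (forall u, m <= g u) -> (forall u, g u <= M) -> 0 < m ->
    0 < \int[mu]_(u in [set: Y]) g u.
  move=> mg gm gM m0; apply: lt_le_trans m0 _.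
  by case/andP: (Rintegral_itv g m M mg gm gM mu).
have K0 : 0 < RREU + RRUD - 1 by lra.
have crr_le : crr * (RREU + RRUD - 1) <= RREU * RRUD.
  rewrite -ler_pdivlMr// /crr /CRR /RRobs /RRtrue.
  rewrite (Rintegral_mixture r rmin rmax mr rm rM _ _ _ _ p01 (ltW hrmin0) lawE).
  rewrite (Rintegral_mixture rs rsmin rsmax mrs rsm rsM _ _ _ _ p01 (ltW hrsmin0) lawE).
  (* Here [K] is [RREU * RRUD / (RREU + RRUD - 1)]; the bounding-factor lemma gives both ratio
     bounds, first for [rs], then for [r]. *)
  apply: ratio_mixture_le => //.
  - exact: (pos _ rs rsmin rsmax).
  - exact: (pos _ rs rsmin rsmax).
  - exact: (pos _ r rmin rmax).
  - exact: (pos _ r rmin rmax).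
  - rewrite mulrAC ler_pdivlMr//.
    exact: (Rintegral_bounding_factor rs rsmin rsmax).
  - rewrite mulrAC ler_pdivlMr//.
    exact: (Rintegral_bounding_factor r rmin rmax).
split; first exact: bounding_factor_min.
exact: bounding_factor_max.
Qed.
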